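(* There exist $b>0$, $\varepsilon_0>0$ and $N_0$ such that the following holds for every $\varepsilon\in(0,\varepsilon_0)$ and every integer $N\ge N_0$. If $u:\mathbb{Z}^2\to\mathbb{R}$ is a discrete harmonic function with $$\max_{Q_{[\sqrt N]}}|u|\ge2$$ and $$|Q_K\cap\{|u|\le1\}|\ge(1-\varepsilon)|Q_K|\qquad\text{for every integer } K\in[\sqrt N,N],$$ then $$\max_{Q_{[N/2]}}|u|\ge e^{bN}.$$
   Context: A function $u:\mathbb{Z}^2\to\mathbb{R}$ is discrete harmonic if its value at every point of $\mathbb{Z}^2$ equals the average of its values at the four adjacent points. For a nonnegative integer $N$, $Q_N=\{(n,m)\in\mathbb{Z}^2:|n|,|m|\le N\}$. $|S|$ is the number of elements of a finite set $S$, $\{|u|\le 1\}$ is the set of points of $\mathbb{Z}^2$ where $|u|\le1$, and $[x]$ is the integer part of $x$. *)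

(* Defs.v *)
From mathcomp Require Import all_boot all_order all_algebra finmap.
From mathcomp Require Import all_classical all_reals all_analysis.
Set Implicit Arguments.
Unset Strict Implicit.
Unset Printing Implicit Defensive.
Import Order.TTheory GRing.Theory Num.Theory.
Local Open Scope classical_set_scope.
Local Open Scope ring_scope.

Definition discrete_harmonic (R : realType) (u : int * int -> R) : Prop :=
  forall n m : int,
    u (n, m) = (u (n + 1, m) + u (n - 1, m) + u (n, m + 1) + u (n, m - 1)) / 4.

Definition Q (N : nat) : set (int * int) :=
  [set p : int * int | `|p.1| <= N%:Z /\ `|p.2| <= N%:Z].

(* [fset_set A] is empty when [A] is infinite; this lemma guarantees that
   [npoints] and [maxQ] below never see that default value. *)
Lemma finite_Q (N : nat) : finite_set (Q N).
Proof.
pose f (p : 'I_(N + N).+1 * 'I_(N + N).+1) : int * int :=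
  ((p.1 : nat)%:Z - N%:Z, (p.2 : nat)%:Z - N%:Z).
have key (a : int) : `|a| <= N%:Z ->
    exists i : 'I_(N + N).+1, (i : nat)%:Z - N%:Z = a.
  rewrite ler_norml => /andP[lo hi].
  have a0 : 0 <= a + N%:Z by rewrite -lerBlDr sub0r.
  have lt : (absz (a + N%:Z)%R < (N + N).+1)%N.
    by rewrite ltnS -lez_nat gez0_abs// PoszD lerD2r.
  by exists (Ordinal lt); rewrite /= gez0_abs// addrK.
apply: (@sub_finite_set _ _ (f @` setT)).
  move=> [a b] [/= /key[i ia] /key[j jb]].
  by exists (i, j) => //; rewrite /f /= ia jb.
exact/finite_image/finite_finset.
Qed.

Definition npoints (S : set (int * int)) : nat := #|` fset_set S |.

(* The default value 0 is harmless: [Q N] contains the origin and the values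
   are nonnegative. *)
Definition maxQ (R : realType) (u : int * int -> R) (N : nat) : R :=
  \big[Num.max/0]_(p <- fset_set (Q N)) `|u p|.

(* Main.v *)
Require Import Defs.
From mathcomp Require Import all_boot all_order all_algebra finmap.
From mathcomp Require Import all_classical all_reals all_analysis.
From mathcomp Require Import zify ring lra.
Import Order.TTheory GRing.Theory Num.Theory.
Set Implicit Arguments.
Unset Strict Implicit.
Unset Printing Implicit Defensive.
Local Open Scope classical_set_scope.
Local Open Scope ring_scope.

(** The gradient of a harmonic function bounded by [M] on a square of radius [r]
is at most [4 M / r]; iterating, the [k]-th difference along a line is at most
[(4 / r) ^ k M] on a square with a margin [k r].  So on a line the function is,
up to an error [2 ^ (- k) M], a polynomial of degree [< k].  If moreover it is
bounded by [A] outside a small proportion of the points of a segment, then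
Lagrange interpolation at [k] almost equally spaced good points around the
centre of the segment bounds it there by [C ^ (k / T) A], where [T] is as large
as we please when the proportion is small.  Using this first on the rows with few
bad points, then on the columns, with [k] proportional to the logarithm of
[M := max_(Q_2K) |u|], gives [(max_(Q_K) |u|) ^ 4 <= M], unless [M] is already
exponentially large in [K] (differences of order larger than [c K] cannot be
estimated on the lattice) or bounded (then the gradient estimate contradicts
[max_(Q_K) |u| >= 2]).  Thus [log max_(Q_K) |u|] is multiplied by at least 4 when
[K] is doubled, until it is linear in [K]; starting from [sqrt N], this happens
before [N / 2]. *)

(** * Polynomial approximation and Lagrange interpolation *)

Definition fdiff (R : zmodType) (f : nat -> R) (x : nat) : R := f x.+1 - f x.

(** By Pascal's rule the error of order [k.+1] at [x.+1] is the error of order [k.+1] at [x] plus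
    the error of order [k] of [fdiff f] at [x]; induction on [k], then on [x], adds the bounds. *)
Lemma newton_remainder (R : realFieldType) (k : nat) (f : nat -> R) (D : R)
    (L : nat) :
  (forall y : nat, (y <= L)%N -> `|iter k (@fdiff R) f y| <= D) ->
  forall x : nat, (x <= L)%N ->
    `|f x - \sum_(j < k) iter j (@fdiff R) f 0%N * 'C(x, j)%:R|
      <= D * 'C(x, k)%:R.
Proof.
elim: k f => [|k IHk] f fD.
  by move=> x xL; rewrite big_ord0 subr0 bin0 mulr1 fD.
have {IHk} IHk := IHk (fdiff f).
elim=> [|x IHx] xL.
  rewrite big_ord_recl /= bin0 mulr1 big1 ?addr0 ?subrr ?normr0 ?bin0n ?mulr0//.
  by move=> j _; rewrite bin0n /= mulr0.
have fk : forall y : nat, (y <= L)%N -> `|iter k (@fdiff R) (fdiff f) y| <= D.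
  by move=> y yL; rewrite -iterSr fD.
have := IHk fk x (ltnW xL).
have := IHx (ltnW xL).
rewrite !big_ord_recl /= !bin0 !mulr1 binS natrD mulrDr => h1 h2.
have -> : \sum_(i < k) fdiff (iter i (@fdiff R) f) 0%N * 'C(x.+1, bump 0 i)%:R =
   \sum_(i < k) fdiff (iter i (@fdiff R) f) 0%N * 'C(x, bump 0 i)%:R +
   \sum_(i < k) iter i (@fdiff R) (fdiff f) 0%N * 'C(x, i)%:R.
  rewrite -big_split; apply: eq_bigr => i _ /=.
  by rewrite binS natrD mulrDr -iterSr.
set S1 := \sum_(i < k) _ in h1 *; set S2 := \sum_(i < k) _ in h2 *.
have -> : f x.+1 - (f 0%N + (S1 + S2)) =
   (f x - (f 0%N + S1)) + (fdiff f x - S2) by rewrite /fdiff; ring.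
by rewrite (le_trans (ler_normD _ _))// lerD.
Qed.

Definition binom_poly (R : fieldType) (j : nat) : {poly R} :=
  (j`!%:R)^-1 *: \prod_(i < j) ('X - (i%:R)%:P).

Lemma size_binom_poly (R : realFieldType) (j : nat) :
  (size (binom_poly R j) <= j.+1)%N.
Proof.
rewrite (leq_trans (size_scale_leq _ _))//.
by rewrite size_prod_XsubC /index_enum -enumT size_enum_ord.
Qed.

Lemma horner_binom_poly (R : realFieldType) (j x : nat) :
  (binom_poly R j).[x%:R] = 'C(x, j)%:R.
Proof.
rewrite /binom_poly hornerZ horner_prod.
have j0 : (j`!%:R : R) != 0 by rewrite pnatr_eq0 -lt0n fact_gt0.
apply: (mulfI j0); rewrite mulrA divff// mul1r -natrM mulnC bin_ffact.
under eq_bigr do rewrite hornerXsubC.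
have [jx|xj] := leqP j x.
  rewrite ffact_prod natr_prod; apply: eq_bigr => i _.
  by rewrite natrB// (leq_trans _ jx)// ltnW.
by rewrite ffact_small// (bigD1 (Ordinal xj))//= subrr mul0r.
Qed.

Lemma newton_approx (R : realFieldType) (k : nat) (f : nat -> R) (D : R)
    (L : nat) :
  (forall y : nat, (y <= L)%N -> `|iter k (@fdiff R) f y| <= D) ->
  exists2 p : {poly R}, (size p <= k)%N &
    forall x : nat, (x <= L)%N -> `|f x - p.[x%:R]| <= D * 'C(x, k)%:R.
Proof.
move=> fD.
exists (\sum_(j < k) iter j (@fdiff R) f 0%N *: binom_poly R j).
  rewrite (leq_trans (size_sum _ _ _))//; apply/bigmax_leqP => i _.
  rewrite (leq_trans (size_scale_leq _ _))//.
  by rewrite (leq_trans (size_binom_poly _ _)).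
move=> x xL; rewrite horner_sum.
under eq_bigr do rewrite hornerZ horner_binom_poly.
exact: newton_remainder xL.
Qed.

(** [p] minus the interpolant has size at most [#|I|] and vanishes at [#|I|] distinct nodes. An
    arbitrary finite index type allows one family of nodes on each side of a centre. *)
Lemma lagrange_interpolation (F : fieldType) (I : finType) (t : I -> F)
    (p : {poly F}) (x : F) :
  injective t -> (size p <= #|I|)%N ->
  p.[x] = \sum_i p.[t i] * \prod_(j | j != i) ((x - t j) / (t i - t j)).
Proof.
move=> t_inj sp.
pose l i := \prod_(j | j != i) ((t i - t j)^-1 *: ('X - (t j)%:P)).
have lE i y : (l i).[y] = \prod_(j | j != i) ((y - t j) / (t i - t j)).
  rewrite horner_prod; apply: eq_bigr => j _.
  by rewrite hornerZ hornerXsubC mulrC.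
suff : p - \sum_i p.[t i] *: l i = 0.
  move/eqP; rewrite subr_eq0 => /eqP {1}->.
  by rewrite horner_sum; apply: eq_bigr => i _; rewrite hornerZ lE.
apply: (@roots_geq_poly_eq0 _ _ (map t (enum I))).
- apply/allP => _ /mapP[i _ ->]; rewrite rootE !hornerE horner_sum.
  rewrite (bigD1 i)//= big1 => [|j ji]; last first.
    by rewrite hornerZ lE (bigD1 i) 1?eq_sym//= subrr mul0r mul0r mulr0.
  rewrite addr0 hornerZ lE big1 ?mulr1 ?subrr// => j ji.
  by rewrite divff// subr_eq0; apply: contra ji => /eqP/t_inj->.
- by rewrite map_inj_uniq// enum_uniq.
- rewrite size_map -cardE (leq_trans (size_polyD _ _))// geq_max sp size_polyN.
  rewrite (leq_trans (size_sum _ _ _))//; apply/bigmax_leqP => i _.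
  rewrite (leq_trans (size_scale_leq _ _))//.
  rewrite /l scaler_prod (leq_trans (size_scale_leq _ _))//.
  rewrite (leq_trans (size_poly_prod_leq _ _))//.
  under eq_bigr do rewrite size_XsubC.
  rewrite sum_nat_const muln2 -addnn -addSn addnK.
  rewrite -(cardC (pred1 i)) card1.
  by rewrite add1n ltnS subset_leq_card//; apply/subsetP => j; rewrite !inE.
Qed.

(** * Well-spaced good points *)

Lemma sorted_ltn_nth_gap (l : seq nat) (i j : nat) :
  sorted ltn l -> (i <= j)%N -> (j < size l)%N ->
  (nth 0 l i + (j - i) <= nth 0 l j)%N.
Proof.
move=> sl ij; elim: j ij => [|j IHj]; first by rewrite leqn0 => /eqP->; lia.
rewrite leq_eqVlt => /orP[/eqP->|ij] jl; first by rewrite subnn addn0.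
have := IHj ij (ltnW jl).
have := sorted_ltn_nth ltn_trans 0%N sl _ _ (ltnW jl) jl (ltnSn j).
by lia.
Qed.

(** With at most [s * h] bad points, the good point of rank [m] lies between [m] and [m + s * h].
    Taking for [a i] the one of rank [i.+1 * h] makes consecutive choices at least [h] apart. *)
Lemma spread_good_points (G : pred nat) (n s h : nat) :
  (0 < h)%N -> (count (predC G) (iota 1 ((n + s) * h)) <= s * h)%N ->
  exists a : nat -> nat,
    (forall i, (i < n)%N ->
       [/\ G (a i), (i.+1 * h <= a i)%N & (a i <= (i.+1 + s) * h)%N]) /\
    (forall i j, (i < j)%N -> (j < n)%N -> (a i + (j - i) * h <= a j)%N).
Proof.
move=> h0 bad; pose N := ((n + s) * h)%N; pose l := seq.filter G (iota 1 N).
have sl : sorted ltn l by rewrite sorted_filter ?iota_ltn_sorted//; exact: ltn_trans.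
have szl : (N <= size l + s * h)%N.
  have := count_predC G (iota 1 N); rewrite size_iota => <-.
  by rewrite size_filter leq_add2l.
have lG k : (k < size l)%N -> G (nth 0%N l k) && (0 < nth 0 l k <= N)%N.
  by move=> /(mem_nth 0%N); rewrite mem_filter mem_iota add1n ltnS => /andP[->].
have idx i : (i < n)%N -> (i.+1 * h <= n * h)%N by move=> ?; rewrite leq_mul2r; lia.
have Nn : N = (n * h + s * h)%N by rewrite /N mulnDl.
have pos i : (0 < i.+1 * h)%N by rewrite muln_gt0.
clearbody l N; exists (fun i => nth 0 l (i.+1 * h).-1)%N; split.
  move=> i /idx ih; have := pos i => hi.
  have ki : ((i.+1 * h).-1 < size l)%N by lia.
  rewrite mulnDl; move: (i.+1 * h)%N ih hi ki => I ih hi ki.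
  have /andP[Gi _] := lG _ ki; split => //.
  - have /lG/andP[_ /andP[+ _]] : (0 < size l)%N by lia.
    have := sorted_ltn_nth_gap sl (leq0n _) ki; lia.
  - have /lG/andP[_ /andP[_ +]] : ((size l).-1 < size l)%N by lia.
    have lt1 : (I.-1 <= (size l).-1)%N by lia.
    have lt2 : ((size l).-1 < size l)%N by lia.
    have := sorted_ltn_nth_gap sl lt1 lt2; lia.
move=> i j ij /idx jh.
have ih : (i.+1 * h + (j - i) * h = j.+1 * h)%N by rewrite -mulnDl; congr muln; lia.
have h1 := pos i; have h2 := pos j.
have lt1 : ((i.+1 * h).-1 <= (j.+1 * h).-1)%N by lia.
have lt2 : ((j.+1 * h).-1 < size l)%N by lia.
have := sorted_ltn_nth_gap sl lt1 lt2; lia.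
Qed.

(** * Size of the Lagrange weights *)

(** With truncated subtraction, [i - j + (j - i)] is the distance of [i] and [j]; the indices below
    and above [i] contribute one factorial each. *)
Lemma prod_dist_ord (n : nat) (i : 'I_n) :
  (\prod_(j < n | j != i) (i - j + (j - i)) = i`! * (n - i.+1)`!)%N.
Proof.
pose F (m : nat) (j : nat) := (if j != m then m - j + (j - m) else 1)%N.
transitivity (\prod_(j < n) F i j)%N; first by rewrite big_mkcond.
have -> : (\prod_(j < n) F i j = \prod_(j < i.+1 + (n - i.+1)) F i j)%N.
  by rewrite subnKC.
elim: (n - i.+1)%N => [|m IHm].
  rewrite addn0 big_ord_recr /= {2}/F eqxx/= fact0 !muln1 -ffactnn ffact_prod.
  by apply: eq_bigr => j _; have ji := ltn_ord j; rewrite /F ifT; lia.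
rewrite addnS big_ord_recr /= IHm /F ifT ?factS; last by lia.
by rewrite -mulnA; congr (_ * _)%N; rewrite mulnC; congr (_ * _)%N; lia.
Qed.

Lemma prod_ord_shift (n m : nat) :
  (\prod_(j < n) (j + m.+1) * m`! = (n + m)`!)%N.
Proof.
elim: n => [|n IHn]; first by rewrite big_ord0 mul1n.
by rewrite big_ord_recr /= mulnAC IHn addSn factS addnS mulnC.
Qed.

Lemma fact_sqr_le (n i : nat) : (i <= n)%N -> (n`! * n`! <= (n - i)`! * (n + i)`!)%N.
Proof.
move=> leq_in; have E1 := ffact_fact leq_in.
have := ffact_fact (leq_addl n i); rewrite addnK => <-.
rewrite -{1}E1 mulnA [X in (_ <= X * _)%N]mulnC !leq_mul//.
rewrite !ffact_prod; apply: leq_prod => j _.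
by rewrite leq_sub2r// leq_addr.
Qed.

(** A crude Stirling bound: [k ^ k] is at most the falling factorial [(k + k) ^_ k], which is k!
    times a central binomial coefficient. *)
Lemma leq_expn_fact (k : nat) : (k ^ k <= 4 ^ k * k`!)%N.
Proof.
have h : (k ^ k <= (k + k) ^_ k)%N.
  rewrite ffact_prod -[X in (_ ^ X)%N]card_ord -prod_nat_const.
  by apply: leq_prod => i _; have := ltn_ord i; lia.
rewrite (leq_trans h)// -bin_ffact leq_mul2r; apply/orP; right.
have -> : (4 ^ k = 2 ^ (k + k))%N by rewrite expnD -expnMn.
have kk : (k < (k + k).+1)%N by lia.
have := Pascal 1 1 (k + k); rewrite addn1 => ->.
by rewrite (bigD1 (Ordinal kk))//= !exp1n !muln1 leq_addr.
Qed.

Lemma leq_bin_expn (m k : nat) : ('C(m, k) * k`! <= m ^ k)%N.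
Proof.
rewrite bin_ffact ffact_prod -[X in (_ ^ X)%N]card_ord -prod_nat_const.
by apply: leq_prod => i _; rewrite leq_subr.
Qed.

(** The left side bounds the total Lagrange weight of [2 * (T * s)] nodes. Its growth rate in [s] is
    only cubic in [T], whereas polynomial approximation gains [2 ^ (2 * T)] per unit of [s]; this
    gap drives the proof. *)
Lemma bin_mul_le (T s : nat) : (0 < T)%N -> (0 < s)%N ->
  (2 * (T * s) * 'C(T * s + s, T * s) ^ 2 <= (64 * T * T.+1 ^ 2) ^ s)%N.
Proof.
move=> T0 s0.
have hC : ('C(T * s + s, T * s) <= (4 * T.+1) ^ s)%N.
  rewrite -[X in (X <= _)%N]bin_sub ?leq_addr// addnC addnK.
  rewrite -(leq_pmul2r (fact_gt0 s)) (leq_trans (leq_bin_expn _ _))//.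
  have -> : (s + T * s = T.+1 * s)%N by rewrite mulSn.
  by rewrite !expnMn -mulnA mulnCA leq_mul2l leq_expn_fact orbT.
have h2 : (2 * (T * s) <= (4 * T) ^ s)%N.
  have -> : (2 * (T * s) = (2 * s) * T)%N by lia.
  rewrite expnMn leq_mul//; last by rewrite -{1}(expn1 T) leq_pexp2l.
  have -> : (4 ^ s = 2 ^ s * 2 ^ s)%N by rewrite -expnMn.
  have s2 : (s < 2 ^ s)%N by rewrite ltn_expl.
  by nia.
have -> : ((64 * T * T.+1 ^ 2) ^ s = (4 * T) ^ s * ((4 * T.+1) ^ s) ^ 2)%N.
  by rewrite -expnM [(s * 2)%N]mulnC expnM -expnMn; congr (_ ^ _)%N; ring.
by rewrite leq_mul// leq_exp2r.
Qed.

(** The factor of index [i] in [P] is at least [i.+1], so [A] is at most P / (i + 1), where P is n!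
    times the binomial coefficient. The denominators multiply to (n - i - 1)! (n + i + 1)! / (i +
    1), which is at least (n!)^2 / (i + 1). *)
Lemma lagrange_weight_nat (n s : nat) (i : 'I_n) :
  ((\prod_(j < n | j != i) (j + s.+1)) * (\prod_(j < n) (j + s.+1)) <=
   'C(n + s, n) ^ 2 * ((\prod_(j < n | j != i) (i - j + (j - i))) *
     (\prod_(j < n) (j + i.+2))))%N.
Proof.
set A := (\prod_(j < n | _) _)%N; set P := (\prod_(j < n) (j + s.+1))%N.
set D := (\prod_(j < n) (j + i.+2))%N; rewrite prod_dist_ord.
have PE : (P = 'C(n + s, n) * n`!)%N.
  apply/eqP; rewrite -(eqn_pmul2r (fact_gt0 s)) prod_ord_shift.
  by have := bin_fact (leq_addr s n); rewrite addKn mulnA => <-.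
have AP : (i.+1 * A <= P)%N.
  by rewrite /P (bigD1 i)//= leq_mul//; lia.
have DE : (D * i.+1`! = (n + i.+1)`!)%N by exact: prod_ord_shift.
rewrite -(leq_pmul2l (ltn0Sn i)) mulnA (leq_trans (leq_mul AP (leqnn P)))//.
have -> : (i.+1 * ('C(n + s, n) ^ 2 * (i`! * (n - i.+1)`! * D)) =
   'C(n + s, n) ^ 2 * ((n - i.+1)`! * (D * i.+1`!)))%N.
  by rewrite factS; ring.
rewrite DE {1 2}PE -mulnA [X in (_ * X)%N]mulnCA mulnA leq_mul//.
exact: fact_sqr_le.
Qed.

(** Factor by factor comparison with the integer model: numerators are at most [(j.+1 + s) * h],
    denominators at least [h] times the distance of the indices, or [(i.+1 + j.+1) * h] across the
    centre, and [h] cancels. *)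
Lemma lagrange_weight_le (R : realFieldType) (a b : nat -> nat) (n s h : nat)
    (i : 'I_n) :
  (0 < h)%N ->
  (forall i, (i < n)%N -> (i.+1 * h <= a i)%N /\ (a i <= (i.+1 + s) * h)%N) ->
  (forall i, (i < n)%N -> (i.+1 * h <= b i)%N /\ (b i <= (i.+1 + s) * h)%N) ->
  (forall i j, (i < j)%N -> (j < n)%N -> (a i + (j - i) * h <= a j)%N) ->
  (\prod_(j < n | j != i) ((a j)%:R / `|(a i)%:R - (a j)%:R|)) *
  (\prod_(j < n) ((b j)%:R / ((a i)%:R + (b j)%:R))) <= ('C(n + s, n) ^ 2)%:R :> R.
Proof.
move=> h0 ha hb gap.
have frac_le (x y A B : nat) (r : R) : (0 < B)%N -> r = y%:R -> (x <= A * h)%N ->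
    (B * h <= y)%N -> 0 <= x%:R / r <= A%:R / B%:R.
  move=> B0 -> xA yB; rewrite divr_ge0//=.
  have y0 : (0 < y)%N by rewrite (leq_trans _ yB)// muln_gt0 B0.
  rewrite ler_pdivrMr ?ltr0n// mulrAC ler_pdivlMr ?ltr0n// -!natrM ler_nat.
  rewrite (leq_trans (leq_mul xA (leqnn B)))// -mulnA leq_mul// mulnC//.
have -> : ('C(n + s, n) ^ 2)%:R = (('C(n + s, n) ^ 2 * ((\prod_(j < n | j != i)
    (i - j + (j - i))) * (\prod_(j < n) (j + i.+2))))%:R /
    ((\prod_(j < n | j != i) (i - j + (j - i)) * (\prod_(j < n) (j + i.+2)))%N)%:R) :> R.
  rewrite natrM mulfK// pnatr_eq0 muln_eq0 negb_or -!lt0n !prodn_cond_gt0//.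
    by move=> j; rewrite addnS.
  by move=> j ji; have : (j != i :> nat) by []; lia.
apply: (@le_trans _ _ ((\prod_(j < n | j != i) (j + s.+1) *
   \prod_(j < n) (j + s.+1))%N%:R /
    ((\prod_(j < n | j != i) (i - j + (j - i)) * (\prod_(j < n) (j + i.+2)))%N)%:R)); last first.
  by rewrite ler_wpM2r ?invr_ge0// ler_nat lagrange_weight_nat.
rewrite !natrM !natr_prod invfM mulrACA -!prodfV -!big_split/=.
apply: ler_pM.
- by apply: prodr_ge0 => j _; rewrite divr_ge0.
- by apply: prodr_ge0 => j _; rewrite divr_ge0// addr_ge0.
- apply: ler_prod => j ji.
  have [ja1 ja2] := ha j (ltn_ord j).
  have ji' : (j != i :> nat) by [].
  apply: (@frac_le _ ((a i - a j) + (a j - a i))%N); first by lia.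
  + have [ij|] := ltnP i j.
      have aij := leq_trans (leq_addr _ _) (gap _ _ ij (ltn_ord j)).
      rewrite distrC ger0_norm ?subr_ge0 ?ler_nat//.
      have -> : (a i - a j = 0)%N by lia.
      by rewrite add0n natrB.
    move=> ji2; have lt_ji : (j < i)%N by lia.
    have aij := leq_trans (leq_addr _ _) (gap _ _ lt_ji (ltn_ord i)).
    rewrite ger0_norm ?subr_ge0 ?ler_nat//.
    have -> : (a j - a i = 0)%N by lia.
    by rewrite addn0 natrB.
  + by rewrite addnS -addSn.
  + have [ij|ji2] := ltnP i j.
      have := gap _ _ ij (ltn_ord j); rewrite mulnDl.
      have -> : ((i - j) * h = 0)%N by have -> : (i - j = 0)%N by lia.
      by lia.
    have lt_ji : (j < i)%N by lia.
    have := gap _ _ lt_ji (ltn_ord i); rewrite mulnDl.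
    have -> : ((j - i) * h = 0)%N by have -> : (j - i = 0)%N by lia.
    by lia.
- apply: ler_prod => j _.
  have [jb1 jb2] := hb j (ltn_ord j); have [ia1 ia2] := ha i (ltn_ord i).
  apply: (@frac_le _ (a i + b j)%N); first by lia.
  + by rewrite natrD.
  + by rewrite addnS -addSn.
  + by rewrite (_ : j + i.+2 = i.+1 + j.+1)%N ?mulnDl ?leq_add//; lia.
Qed.

(* The nodes [x + a false i] and [x - a true i] lie on both sides of [x]; this is
   what makes the Lagrange weights at [x] small. *)
Lemma poly_bound_from_nodes (R : realFieldType) (p : {poly R}) (n s h x : nat)
    (a : bool -> nat -> nat) (A : R) :
  (0 < h)%N -> (size p <= 2 * n)%N ->
  (forall c i, (i < n)%N -> (i.+1 * h <= a c i)%N /\ (a c i <= (i.+1 + s) * h)%N) ->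
  (forall c i j, (i < j)%N -> (j < n)%N -> (a c i + (j - i) * h <= a c j)%N) ->
  (forall (c : bool) i, (i < n)%N ->
    `|p.[x%:R + (-1) ^+ c * (a c i)%:R]| <= A) ->
  `|p.[x%:R]| <= A * (2 * n * 'C(n + s, n) ^ 2)%:R.
Proof.
move=> h0 sp ha gap pA.
pose t (i : bool * 'I_n) : R := x%:R + (-1) ^+ i.1 * (a i.1 i.2)%:R.
have apos c (i : 'I_n) : (0 < a c i)%N.
  by have [+ _] := ha c i (ltn_ord i); apply: leq_trans; rewrite muln_gt0.
have aneq c (i j : 'I_n) : i != j -> a c i != a c j.
  move=> ij; have : (i != j :> nat) by [].
  rewrite neq_ltn => /orP[] lt_ij.
    have := gap c _ _ lt_ij (ltn_ord j).
    have : (0 < (j - i) * h)%N by rewrite muln_gt0 subn_gt0 lt_ij.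
    lia.
  have := gap c _ _ lt_ij (ltn_ord i).
  have : (0 < (i - j) * h)%N by rewrite muln_gt0 subn_gt0 lt_ij.
  lia.
have t_inj : injective t.
  move=> [c i] [d j]; rewrite /t/= => /addrI.
  have ap : (0 : R) < (a c i)%:R by rewrite ltr0n.
  have bp : (0 : R) < (a d j)%:R by rewrite ltr0n.
  have [->|cd] := eqVneq c d.
    have d0 : (-1) ^+ d != 0 :> R by rewrite signr_eq0.
    move=> /(mulfI d0) /eqP.
    rewrite eqr_nat => /eqP aij; congr pair; apply/eqP; apply: contraT => ij.
    by have := aneq d i j ij; rewrite aij eqxx.
  move=> eq_cd; exfalso; move: ap bp cd eq_cd.
  move: (a c i)%:R (a d j)%:R => r r'; clear.
  by case: c; case: d => //= r0 r'0 _; rewrite ?expr1 ?expr0; lra.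
rewrite (lagrange_interpolation x%:R t_inj); last first.
  by rewrite card_prod card_bool card_ord.
rewrite (le_trans (ler_norm_sum _ _ _))//.
have -> : A * (2 * n * 'C(n + s, n) ^ 2)%:R =
    \sum_(i : bool * 'I_n) A * ('C(n + s, n) ^ 2)%:R.
  by rewrite sumr_const card_prod card_bool card_ord -mulrnAr -mulrnA mulnC.
apply: ler_sum => -[c i] _; rewrite normrM ler_pM//; first exact: pA.
rewrite normr_prod.
apply: le_trans (lagrange_weight_le (b := a (~~ c)) R i h0 (ha c) (ha (~~ c)) (gap c)).
have -> : (\prod_(j | j != (c, i)) `|(x%:R - t j) / (t (c, i) - t j)|) =
   \prod_(d : bool) \prod_(j < n | (d, j) != (c, i)) `|(x%:R - t (d, j)) / (t (c, i) - t (d, j))|.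
  by rewrite pair_big_dep/=; apply: eq_big => [[]|[]].
rewrite (bigD1 c)//= (big_pred1 (~~ c)); last by case: c => [] [].
rewrite ler_pM ?prodr_ge0//.
- rewrite le_eqVlt; apply/orP; left; apply/eqP.
  apply: eq_big => [j|j _]; first by rewrite xpair_eqE eqxx.
  rewrite /t/= normrM normfV; congr (_ / _).
    by rewrite opprD addNKr normrN normrM normr_sign mul1r normr_nat.
  have -> : x%:R + (-1) ^+ c * (a c i)%:R - (x%:R + (-1) ^+ c * (a c j)%:R) =
     (-1) ^+ c * ((a c i)%:R - (a c j)%:R) :> R by ring.
  by rewrite normrM normr_sign mul1r.
- rewrite le_eqVlt; apply/orP; left; apply/eqP.
  apply: eq_big => [j|j _]; first by rewrite xpair_eqE; case: c.
  rewrite /t/= normrM normfV; congr (_ / _).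
    by rewrite opprD addNKr normrN normrM normr_sign mul1r normr_nat.
  have -> : x%:R + (-1) ^+ c * (a c i)%:R - (x%:R + (-1) ^+ (~~ c) * (a (~~ c) j)%:R) =
     (-1) ^+ c * ((a c i)%:R + (a (~~ c) j)%:R) :> R.
     by case: c; rewrite /= ?expr1 ?expr0; ring.
  by rewrite normrM normr_sign mul1r -natrD normr_nat.
Qed.

(** * A discrete Remez inequality *)

(** [pos d] is the point at distance [d] from the centre of the segment, to the left or to the right
    according to [sgn]; the bad points on one side are among all bad points of the segment. *)
Lemma half_good_points (good : pred nat) (sgn : bool) (n s h : nat) :
  (0 < h)%N ->
  (forall l : seq nat, uniq l ->
     all (fun y => (y <= 2 * ((n + s) * h))%N && ~~ good y) l ->
     (size l <= s * h)%N) ->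
  let pos d := (if sgn then (n + s) * h - d else (n + s) * h + d)%N in
  exists a : nat -> nat,
    (forall i, (i < n)%N ->
       [/\ good (pos (a i)), (i.+1 * h <= a i)%N & (a i <= (i.+1 + s) * h)%N]) /\
    (forall i j, (i < j)%N -> (j < n)%N -> (a i + (j - i) * h <= a j)%N).
Proof.
move=> h0 sparse pos; apply: (@spread_good_points (fun d => good (pos d))) => //.
rewrite -size_filter -(size_map pos); apply: sparse.
  rewrite map_inj_in_uniq ?filter_uniq ?iota_uniq// => x y.
  rewrite !mem_filter !mem_iota /pos; case: sgn {pos} => /andP[_ +] /andP[_ +]; lia.
apply/allP => y /mapP[d]; rewrite mem_filter mem_iota /= => /andP[bad +] ->.
by rewrite bad andbT /pos; case: sgn {pos bad}; lia.
Qed.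

(** Newton's polynomial is within [e = M / 2 ^+ k] of [f], so it is at most [A + e] at [T * s]
    well-spaced good points on each side of the centre, and Lagrange interpolation bounds it at the
    centre. Returning to [f] there costs [e] once more. *)
Lemma discrete_remez (R : realFieldType) (T s h : nat) (f : nat -> R)
    (good : pred nat) (A M : R) :
  (0 < T)%N -> (0 < s)%N -> (0 < h)%N ->
  (forall y, (y <= 2 * (T.+1 * s * h))%N ->
     `|iter (2 * (T * s)) (@fdiff R) f y| <= M / (16 * h%:R) ^+ (2 * (T * s))) ->
  (forall y, (y <= 2 * (T.+1 * s * h))%N -> good y -> `|f y| <= A) ->
  (forall l : seq nat, uniq l ->
     all (fun y => (y <= 2 * (T.+1 * s * h))%N && ~~ good y) l ->
     (size l <= s * h)%N) ->
  `|f (T.+1 * s * h)%N| <=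
     (A + 2 * (M / 2 ^+ (2 * (T * s)))) * ((64 * T * T.+1 ^ 2) ^ s)%:R.
Proof.
move=> T0 s0 h0; set k := (2 * (T * s))%N; set n := (T * s)%N.
have -> : (T.+1 * s * h = (n + s) * h)%N by rewrite mulSn addnC.
set r := ((n + s) * h)%N => fM fA sparse.
have n0 : (0 < n)%N by rewrite muln_gt0 T0.
pose D := M / (16 * h%:R) ^+ k.
have D0 : 0 <= D by apply: le_trans (normr_ge0 _) (fM 0%N _).
have h16 : 0 < (16 * h%:R) ^+ k :> R by rewrite exprn_gt0// mulr_gt0// ltr0n.
have M0 : 0 <= M by move: D0; rewrite /D pmulr_lge0// invr_gt0.
have [p sp pf] := newton_approx fM.
pose e := M / 2 ^+ k.
have e0 : 0 <= e by rewrite divr_ge0// exprn_ge0.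
(* ['C(2 * r, k)] is at most the [k]-th power of 8 r / k, and 8 r / k is at most 8 h since [T] is
   positive; the 16 in the hypothesis leaves a factor 1/2 per difference. *)
have eD : D * 'C(2 * r, k)%:R <= e.
  have c1 : ('C(2 * r, k) * k ^ k <= (4 * (2 * r)) ^ k)%N.
    rewrite (leq_trans (leq_mul (leqnn _) (leq_expn_fact k)))// mulnCA expnMn.
    by rewrite leq_mul2l leq_bin_expn orbT.
  have c2 : ((4 * (2 * r)) ^ k * 2 ^ k <= (16 * h) ^ k * k ^ k)%N.
    rewrite -!expnMn leq_exp2r//; last by rewrite muln_gt0.
    rewrite /k /r /n; nia.
  rewrite /D /e ler_pdivlMr ?exprn_gt0// -!mulrA -[leRHS]mulr1 ler_wpM2l//.
  rewrite ler_pdivrMl// mulr1.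
  have k0 : 0 < (k ^ k)%:R :> R by rewrite ltr0n expn_gt0 muln_gt0 n0.
  rewrite -(ler_pM2r k0) -natrX -!natrM -natrX -!natrM ler_nat.
  rewrite (leq_trans _ c2)// mulnAC leq_mul2r c1 orbT//.
have pfe x : (x <= 2 * r)%N -> `|f x - p.[x%:R]| <= e.
  move=> xr; rewrite (le_trans (pf x xr))// (le_trans _ eD)// ler_wpM2l// ler_nat.
  exact: leq_bin2l.
have [a1 [ha1 gap1]] := half_good_points true h0 sparse.
have [a0 [ha0 gap0]] := half_good_points false h0 sparse.
pose a (c : bool) := if c then a1 else a0.
have ub c i : (i < n)%N -> (a c i <= r)%N.
  move=> ni; have : ((i.+1 + s) * h <= r)%N by rewrite leq_mul2r leq_add2r ni orbT.
  by apply: leq_trans; case: c; [have [] := ha1 i ni|have [] := ha0 i ni].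
have pr : `|p.[r%:R]| <= (A + e) * (2 * n * 'C(n + s, n) ^ 2)%:R.
  apply: (poly_bound_from_nodes (a := a) h0 sp).
  - by move=> [] i ni; [have [] := ha1 i ni|have [] := ha0 i ni].
  - by case.
  - move=> c i ni.
    have [x [xr gx ->]] : exists x, [/\ (x <= 2 * r)%N, good x &
       r%:R + (-1) ^+ c * (a c i)%:R = x%:R :> R].
      have := ub c i ni; case: c => aub.
        exists (r - a1 i)%N; split; [lia | by have [] := ha1 i ni |].
        by rewrite expr1 mulN1r natrB.
      exists (r + a0 i)%N; split; [move: aub; rewrite /a; lia | by have [] := ha0 i ni |].
      by rewrite expr0 mul1r natrD.
    have := pfe x xr; rewrite distrC => pe.
    rewrite -[p.[_]](subrK (f x)) addrC (le_trans (ler_normD _ _))// lerD//.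
    exact: fA.
have A0 : 0 <= A + e.
  have ni : (0 < n)%N by [].
  have [g _ au] := ha0 0%N ni.
  have u0 := ub false 0%N ni.
  by rewrite addr_ge0// (le_trans (normr_ge0 _) (fA _ _ g))//; move: u0; rewrite /a; lia.
have L1 := bin_mul_le T0 s0.
have C1 : (1 : R) <= ((64 * T * T.+1 ^ 2) ^ s)%:R.
  by rewrite ler1n expn_gt0 !muln_gt0 T0.
have -> : f r = (f r - p.[r%:R]) + p.[r%:R] by rewrite subrK.
rewrite (le_trans (ler_normD _ _))//.
have r2 : (r <= 2 * r)%N by lia.
rewrite (le_trans (lerD (pfe r r2) pr))//.
have -> : A + 2 * (M / 2 ^+ k) = e + (A + e) by rewrite /e; ring.
rewrite [leRHS]mulrDl lerD//; first by rewrite ler_peMr.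
by rewrite ler_wpM2l// ler_nat.
Qed.

(** * Differences of discrete harmonic functions *)

(* [v] is the difference of a harmonic function and its reflection in the line
   [n = 1 / 2].  With [t = n - 1 / 2], the barrier [w = m ^ 2 + 2 t (2 r - t)] is
   strictly superharmonic, at least [r ^ 2] on the sides of the half square away
   from the line, and of order [r] at the point [(1, 0)]. *)
Lemma reflection_barrier (R : realFieldType) (v : int -> int -> R) (r : nat) (M : R) :
  (0 < r)%N -> 0 <= M ->
  (forall n m : int, 1 <= n -> n < r%:Z -> `|m| < r%:Z ->
     4 * v n m = v (n + 1) m + v (n - 1) m + v n (m + 1) + v n (m - 1)) ->
  (forall m : int, v 0 m = - v 1 m) ->
  (forall n m : int, 1 <= n -> n <= r%:Z -> `|m| <= r%:Z -> v n m <= 2 * M) ->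
  v 1 0 <= 4 * M / r%:R.
Proof.
move=> r0 M0 hv v0 vM.
have rR : 1 <= r%:R :> R by rewrite ler1n.
have [M00|Mn0] := eqVneq M 0.
  by have := vM 1 0; rewrite normr0 M00 !mulr0 mul0r; apply; lia.
have Mp : 0 < M by rewrite lt_def Mn0.
pose w (n m : int) : R := m%:~R ^+ 2 + 2 * (n%:~R - 1 / 2) * (2 * r%:R - n%:~R + 1 / 2).
pose g n m := 2 * M * w n m - r%:R ^+ 2 * v n m.
(* Since [w 1 0] is 2 r - 1/2, this bounds [r ^ 2 * v 1 0] by [4 * M * r]. It is obtained by showing
   that the minimum of [g] over the half square is nonnegative. *)
suff : 0 <= g 1 0.
  rewrite /g /w => h; rewrite ler_pdivlMr; last by lra.
  have {}h : r%:R * (v 1 0 * r%:R) <= r%:R * (4 * M) by rewrite rmorph1 in h; nra.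
  by rewrite ler_pM2l in h => //; lra.
have bnd (n m : int) : 1 <= n -> n <= r%:Z -> `|m| <= r%:Z -> r%:R ^+ 2 <= w n m -> 0 <= g n m.
  move=> n1 nr mr wr; have := vM n m n1 nr mr; rewrite /g; nra.
pose F (p : 'I_r * 'I_(r + r).+1) := g ((p.1 : nat)%:Z + 1) ((p.2 : nat)%:Z - r%:Z).
have i0 : 'I_r * 'I_(r + r).+1 by exact: (Ordinal r0, ord0).
have [n [m [n1 nr mr gmin]]] : exists n m : int, [/\ 1 <= n, n <= r%:Z, `|m| <= r%:Z &
    forall a b : int, 1 <= a -> a <= r%:Z -> `|b| <= r%:Z -> g n m <= g a b].
  case: (@Order.TotalTheory.arg_minP _ _ _ i0 xpredT F isT) => -[i j] _ ij_min.
  exists ((i : nat)%:Z + 1), ((j : nat)%:Z - r%:Z).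
  split; [lia | have := ltn_ord i; lia | have := ltn_ord j; lia |].
  move=> a b a1 ar br.
  have ia : (absz (a - 1)%R < r)%N by lia.
  have jb : (absz (b + r%:Z)%R < (r + r).+1)%N by lia.
  have := ij_min (Ordinal ia, Ordinal jb) isT; rewrite /F/=.
  have -> : (absz (a - 1))%:Z + 1 = a by lia.
  by have -> : (absz (b + r%:Z))%:Z - r%:Z = b by lia.
apply: le_trans (gmin 1 0 _ _ _) => //; try lia.
have n1R : 1 <= n%:~R :> R by rewrite ler1z.
have nrR : n%:~R <= r%:R :> R by rewrite -[r%:R]/(r%:Z%:~R) ler_int.
have [nr'|nr'] := eqVneq n r%:Z.
  apply: bnd => //; rewrite /w nr' -[(Posz r)%:~R]/(r%:R : R).
  have : 0 <= m%:~R ^+ 2 :> R by exact: sqr_ge0.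
  nra.
have [mr'|mr'] := eqVneq `|m| r%:Z.
  apply: bnd => //; rewrite /w -[m%:~R ^+ 2]real_normK ?num_real// -intr_norm mr'.
  rewrite -[(Posz r)%:~R]/(r%:R : R); nra.
(* Strict superharmonicity: the term [4 * M] excludes a minimum at a point all of whose neighbours
   are in the half square. *)
have lap : 4 * g n m = g (n + 1) m + g (n - 1) m + g n (m + 1) + g n (m - 1) + 4 * M.
  have hvn : 4 * v n m = v (n + 1) m + v (n - 1) m + v n (m + 1) + v n (m - 1).
    by apply: hv; clear -n1 nr mr nr' mr'; lia.
  rewrite /g mulrBr [4 * (_ ^+ 2 * _)]mulrCA hvn /w !intrD !intrN !rmorph1.
  by field.
have g1 := gmin n (m + 1); have g2 := gmin n (m - 1); have g3 := gmin (n + 1) m.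
have {}g1 : g n m <= g n (m + 1) by apply: g1; clear -n1 nr mr nr' mr'; lia.
have {}g2 : g n m <= g n (m - 1) by apply: g2; clear -n1 nr mr nr' mr'; lia.
have {}g3 : g n m <= g (n + 1) m by apply: g3; clear -n1 nr mr nr' mr'; lia.
have [nE|nE] := eqVneq n 1; last first.
  have : g n m <= g (n - 1) m by apply: gmin; clear -n1 nr mr nr' mr' nE; lia.
  lra.
(* For [n = 1] one neighbour lies across the line; antisymmetry of [v] expresses [g 0 m] through
   [g 1 m], and the minimum is then nonnegative. *)
have gE : g 0 m + g 1 m = 2 * M * (2 * m%:~R ^+ 2 - 1).
  by rewrite /g v0 /w rmorph1 rmorph0; field.
move: lap g1 g2 g3; rewrite nE subrr.
have : 0 <= M * m%:~R ^+ 2 by rewrite mulr_ge0// sqr_ge0.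
lra.
Qed.

(** Subtract from [u] its reflection in the vertical line halfway between [x] and [x + 1]: the value
    next to the line is exactly the increment. The barrier estimate applies to this difference and
    to its opposite. *)
Lemma harmonic_gradient (R : realType) (u : int * int -> R) (x y : int) (r : nat) (M : R) :
  discrete_harmonic u -> (0 < r)%N ->
  (forall n m : int, `|n - x| <= r%:Z -> `|m - y| <= r%:Z -> `|u (n, m)| <= M) ->
  `|u (x + 1, y) - u (x, y)| <= 4 * M / r%:R.
Proof.
move=> hu r0 uM.
have M0 : 0 <= M by apply: le_trans (normr_ge0 _) (uM x y _ _); lia.
pose v (n m : int) := u (x + n, y + m) - u (x + 1 - n, y + m).
have vE : v 1 0 = u (x + 1, y) - u (x, y) by rewrite /v addr0 addrK.
have hv (n m : int) : 4 * v n m = v (n + 1) m + v (n - 1) m + v n (m + 1) + v n (m - 1).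
  rewrite /v; have := hu (x + n) (y + m); have := hu (x + 1 - n) (y + m).
  rewrite (_ : x + (n + 1) = x + n + 1); last by lia.
  rewrite (_ : x + 1 - (n + 1) = x + 1 - n - 1); last by lia.
  rewrite (_ : x + (n - 1) = x + n - 1); last by lia.
  rewrite (_ : x + 1 - (n - 1) = x + 1 - n + 1); last by lia.
  by rewrite !addrA; lra.
have v0 (m : int) : v 0 m = - v 1 m by rewrite /v subr0 addr0 addrK opprB.
have vM (n m : int) : 1 <= n -> n <= r%:Z -> `|m| <= r%:Z -> `|v n m| <= 2 * M.
  move=> n1 nr mr; rewrite (le_trans (ler_normB _ _))//.
  have : `|u (x + n, y + m)| <= M by apply: uM; lia.
  have : `|u (x + 1 - n, y + m)| <= M by apply: uM; lia.
  lra.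
rewrite -vE ler_norml lerNl; apply/andP; split.
  apply: (@reflection_barrier _ (fun n m => - v n m)) => //.
  - by move=> n m _ _ _; rewrite mulrN hv !opprD.
  - by move=> m; rewrite v0.
  - by move=> n m n1 nr mr; have := vM n m n1 nr mr; rewrite ler_norml => /andP[]; lra.
apply: reflection_barrier => //.
by move=> n m n1 nr mr; have := vM n m n1 nr mr; rewrite ler_norml => /andP[].
Qed.

(** * Iterated differences and bounds along rows *)

Definition swap_coord (R : realType) (u : int * int -> R) (p : int * int) : R :=
  u (p.2, p.1).

Lemma harmonic_swap (R : realType) (u : int * int -> R) :
  discrete_harmonic u -> discrete_harmonic (swap_coord u).
Proof. by move=> hu n m; rewrite /swap_coord/= hu; congr (_ / _); lra. Qed.

Definition xdiff (R : realType) (u : int * int -> R) (p : int * int) : R :=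
  u (p.1 + 1, p.2) - u p.

Lemma harmonic_iter_xdiff (R : realType) (u : int * int -> R) (k : nat) :
  discrete_harmonic u -> discrete_harmonic (iter k (@xdiff R) u).
Proof.
move=> hu; elim: k => //= k IHk n m.
rewrite /xdiff/= (IHk n m) (IHk (n + 1) m) subrK addrK.
by lra.
Qed.

Lemma iter_xdiff_bound (R : realType) (u : int * int -> R) (r k J : nat) (M : R) :
  discrete_harmonic u -> (0 < r)%N ->
  (forall p, Q (J + k * r) p -> `|u p| <= M) ->
  forall p, Q J p -> `|iter k (@xdiff R) u p| <= M * (4 / r%:R) ^+ k.
Proof.
move=> hu r0; elim: k J => [|k IHk] J uM p pJ.
  by rewrite expr0 mulr1; apply: uM; rewrite addn0.
have {}IHk := IHk (J + r)%N.
have {}IHk : forall p, Q (J + r) p -> `|iter k (@xdiff R) u p| <= M * (4 / r%:R) ^+ k.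
  by apply: IHk => q; rewrite -addnA -mulSn; exact: uM.
case: p pJ => x y [/= xJ yJ]; rewrite {1}/xdiff/=.
rewrite exprS.
have -> : M * (4 / r%:R * (4 / r%:R) ^+ k) = 4 * (M * (4 / r%:R) ^+ k) / r%:R by ring.
apply: harmonic_gradient => //; first exact: harmonic_iter_xdiff.
move=> n m nx my; apply: IHk; split => /=; lia.
Qed.

Lemma iter_fdiff_row (R : realType) (u : int * int -> R) (x j : int) (k y : nat) :
  iter k (@fdiff R) (fun i => u (x + i%:Z, j)) y =
  iter k (@xdiff R) u (x + y%:Z, j).
Proof.
elim: k y => //= k IHk y; rewrite {1}/fdiff {1}/xdiff/= !IHk.
by rewrite intS [1 + _]addrC addrA.
Qed.

Lemma harmonic_row_bound (R : realType) (u : int * int -> R) (T s h K : nat)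
    (x j : int) (good : pred int) (A M : R) :
  discrete_harmonic u -> (0 < T)%N -> (0 < s)%N -> (0 < h)%N ->
  (130 * (T.+1 * s * h) <= K)%N -> `|x| <= K%:Z ->
  `|j| <= (K + T.+1 * s * h)%N%:Z ->
  (forall p, Q (2 * K) p -> `|u p| <= M) ->
  (forall i, `|i - x| <= (T.+1 * s * h)%N%:Z -> good i -> `|u (i, j)| <= A) ->
  (forall l : seq int, uniq l ->
     all (fun i => (`|i - x| <= (T.+1 * s * h)%N%:Z) && ~~ good i) l ->
     (size l <= s * h)%N) ->
  `|u (x, j)| <=
     (A + 2 * (M / 2 ^+ (2 * (T * s)))) * ((64 * T * T.+1 ^ 2) ^ s)%:R.
Proof.
move=> hu T0 s0 h0 hK xK jK uM uA sparse; set r0 := (T.+1 * s * h)%N.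
pose f i := u (x - r0%:Z + i%:Z, j).
have -> : u (x, j) = f r0 by rewrite /f subrK.
apply: (@discrete_remez R T s h f (fun y => good (x - r0%:Z + y%:Z))) => //.
- move=> y yr; rewrite iter_fdiff_row.
  have -> : M / (16 * h%:R) ^+ (2 * (T * s)) =
      M * (4 / (64 * h)%N%:R) ^+ (2 * (T * s)) :> R.
    rewrite natrM -exprVn; congr (_ * _ ^+ _).
    have : h%:R != 0 :> R by rewrite pnatr_eq0 -lt0n.
    by move=> hh; field.
  apply: (@iter_xdiff_bound R u (64 * h) _ (K + r0)) => //.
  + by rewrite muln_gt0.
  + move=> p pQ; apply: uM; case: pQ => p1 p2.
    have : (K + r0 + 2 * (T * s) * (64 * h) <= 2 * K)%N.
      have -> : (2 * (T * s) * (64 * h) = 128 * (T * s * h))%N by ring.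
      have : (T * s * h <= r0)%N by rewrite /r0 mulSn mulnDl leq_addl.
      move: hK; rewrite -/r0; lia.
    by move=> le2; split; [apply: (le_trans p1)|apply: (le_trans p2)]; rewrite lez_nat.
  + by split => /=; rewrite -/r0 in yr jK; lia.
- by move=> y yr; apply: uA; rewrite -/r0 in yr *; lia.
- move=> l ul al; rewrite -(size_map (fun y : nat => x - r0%:Z + y%:Z)).
  apply: sparse; first by rewrite map_inj_uniq// => a b /addrI[].
  apply/allP => _ /mapP[y yl ->]; move/allP: al => /(_ y yl) /andP[yr ->].
  by rewrite andbT -/r0 in yr *; lia.
Qed.

Lemma harmonic_walk_bound (R : realType) (u : int * int -> R) (r d L : nat)
    (x y : int) (M : R) :
  discrete_harmonic u -> (0 < r)%N ->
  (forall p, Q L p -> `|u p| <= M) ->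
  `|x| + d%:Z + r%:Z <= L%:Z -> `|y| + r%:Z <= L%:Z ->
  `|u (x + d%:Z, y) - u (x, y)| <= d%:R * (4 * M / r%:R).
Proof.
move=> hu r0 uM; elim: d => [|d IHd] xL yL.
  by rewrite addr0 subrr normr0 mul0r.
have {}IHd : `|u (x + d%:Z, y) - u (x, y)| <= d%:R * (4 * M / r%:R) by apply: IHd; lia.
have grad : `|u (x + d%:Z + 1, y) - u (x + d%:Z, y)| <= 4 * M / r%:R.
  by apply: harmonic_gradient => // n m nx my; apply: uM; split => /=; lia.
rewrite intS [1 + _]addrC addrA -natr1 mulrDl mul1r.
have -> : u (x + d%:Z + 1, y) - u (x, y) =
  (u (x + d%:Z, y) - u (x, y)) + (u (x + d%:Z + 1, y) - u (x + d%:Z, y)) by ring.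
by rewrite (le_trans (ler_normD _ _))// lerD.
Qed.

(** * Growth from [Q K] to [Q (2 * K)] *)

Lemma maxQ_ge (R : realType) (u : int * int -> R) (N : nat) (p : int * int) :
  Q N p -> `|u p| <= maxQ u N.
Proof.
move=> pN; apply: (@le_bigmax_seq _ _ _ _ _ p xpredT (fun p => `|u p|)) => //.
by rewrite in_fset_set ?inE//; exact: finite_Q.
Qed.

Lemma maxQ_le (R : realType) (u : int * int -> R) (N : nat) (c : R) :
  0 <= c -> (forall p, Q N p -> `|u p| <= c) -> maxQ u N <= c.
Proof.
move=> c0 uc; rewrite /maxQ big_seq; apply: bigmax_le => // p.
by rewrite in_fset_set ?inE => [/uc//|]; exact: finite_Q.
Qed.

Lemma maxQ_mono (R : realType) (u : int * int -> R) (N N' : nat) :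
  (N <= N')%N -> maxQ u N <= maxQ u N'.
Proof.
move=> NN'; apply: maxQ_le.
  by apply: le_trans (normr_ge0 (u (0, 0))) (maxQ_ge u _); split; rewrite normr0.
move=> p [p1 p2]; apply: maxQ_ge; split; [apply: (le_trans p1)|apply: (le_trans p2)];
  by rewrite lez_nat.
Qed.

Lemma npoints_Q_le (N : nat) : (npoints (Q N) <= (N + N).+1 ^ 2)%N.
Proof.
pose f (p : 'I_(N + N).+1 * 'I_(N + N).+1) : int * int :=
  ((p.1 : nat)%:Z - N%:Z, (p.2 : nat)%:Z - N%:Z).
pose e := [seq f p | p <- enum {: 'I_(N + N).+1 * 'I_(N + N).+1}].
rewrite /npoints; apply: (@leq_trans #|` [fset p in e]%fset|); last first.
  by rewrite card_fseq (leq_trans (size_undup _))// size_map -cardE card_prod !card_ord.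
apply: fsubset_leq_card; apply/fsubsetP => -[x y].
rewrite in_fset_set ?inE => [[/= xN yN]|]; last exact: finite_Q.
have xi : (absz (x + N%:Z)%R < (N + N).+1)%N by lia.
have yi : (absz (y + N%:Z)%R < (N + N).+1)%N by lia.
apply/mapP; exists (Ordinal xi, Ordinal yi); first by rewrite mem_enum.
by rewrite /f /=; congr pair; lia.
Qed.

(** * Counting bad points and dense rows *)

(** Bad points are counted by the lengths of duplicate-free lists satisfying a boolean predicate, a
    form that passes directly to rows and segments. *)
Definition large_in (R : realType) (u : int * int -> R) (N : nat) :
    pred (int * int) :=
  fun p => [&& `|p.1| <= N%:Z, `|p.2| <= N%:Z & 1 < `|u p|].

Lemma size_large_in_le (R : realType) (u : int * int -> R) (N : nat) (eps : R)
    (l : seq (int * int)) :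
  (1 - eps) * (npoints (Q N))%:R <=
     (npoints (Q N `&` [set p : int * int | `|u p| <= 1]))%:R ->
  0 <= eps -> uniq l ->
  all (large_in u N) l ->
  (size l)%:R <= eps * ((N + N).+1 ^ 2)%:R.
Proof.
move=> dens eps0 ul al.
have fQ := finite_Q N.
have fG : finite_set (Q N `&` [set p : int * int | `|u p| <= 1]).
  by apply: sub_finite_set fQ => p [].
have cl : (size l + npoints (Q N `&` [set p : int * int | (`|u p| <= 1)%R])
    <= npoints (Q N))%N.
  have <- : #|` [fset x in l]%fset| = size l by rewrite card_fseq undup_id.
  rewrite /npoints addnC -cardfsUI.
  rewrite [X in (_ + X)%N](_ : _ = 0%N) ?addn0.
    apply: fsubset_leq_card; apply/fsubsetP => p; rewrite !in_fsetE => /orP[].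
      by rewrite !in_fset_set// !inE => -[].
    by move/(allP al) => /and3P[? ? _]; rewrite in_fset_set// inE.
  apply/eqP; rewrite cardfs_eq0; apply/eqP/fsetP => p; rewrite !in_fsetE.
  apply/negP => /andP[]; rewrite in_fset_set// inE => -[_ /= p1] /(allP al).
  by move=> /and3P[_ _]; rewrite ltNge p1.
have : (npoints (Q N))%:R <= ((N + N).+1 ^ 2)%N%:R :> R by rewrite ler_nat npoints_Q_le.
move: cl; rewrite -(ler_nat R) natrD; nra.
Qed.

Definition sparse_row (bad : pred (int * int)) (H : nat) (j : int) : bool :=
  `[< forall l : seq int, uniq l -> all (fun i => bad (i, j)) l -> (size l <= H)%N >].

(** Picking [H.+1] bad points on each dense row of [l] produces [size l * H.+1] distinct bad points,
    hence at most [H ^ 2]. *)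
Lemma few_dense_rows (bad : pred (int * int)) (H : nat) :
  (forall l : seq (int * int), uniq l -> all bad l -> (size l <= H ^ 2)%N) ->
  forall l : seq int, uniq l -> all (fun j => ~~ sparse_row bad H j) l -> (size l <= H)%N.
Proof.
move=> few l ul al.
have /choice[F FP] : forall j, exists t : seq int, ~~ sparse_row bad H j ->
    [/\ uniq t, all (fun i => bad (i, j)) t & size t = H.+1].
  move=> j; have [//|sj] := boolP (sparse_row bad H j); first by exists [::].
  move/asboolPn : sj => /existsNP[t /not_implyP[ut /not_implyP[bt /negP szt]]].
  rewrite -ltnNge in szt; exists (take H.+1 t) => _; split.
  - exact: take_uniq.
  - by apply/allP => i /mem_take; exact: (allP bt).
  - by rewrite size_takel.
have := few [seq (i, j) | j <- l, i <- F j].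
have -> : size [seq (i, j) | j <- l, i <- F j] = (size l * H.+1)%N.
  rewrite size_allpairs_dep -sum1_size big_distrl /= sumnE big_map.
  rewrite !big_seq; apply: eq_bigr => j jl.
  by rewrite mul1n; have [_ _ ->] := FP j (allP al j jl).
have H1 : [/\ uniq [seq (i, j) | j <- l, i <- F j] & all bad [seq (i, j) | j <- l, i <- F j]].
  split.
    apply: allpairs_uniq_dep => // [j jl|[j i] [j' i'] _ _ /= [-> ->]//].
    by have [] := FP j (allP al j jl).
  apply/allP => _ /allpairsPdep[j [i [jl iF ->]]].
  by have [_ /allP + _] := FP j (allP al j jl); apply.
case: H1 => h1 h2 /(_ h1 h2).
have [//|] := leqP (size l) H; nia.
Qed.

(** The case of bounded [M]. From any point of [Q K], at most [H.+1] steps up reach a sparse row and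
    at most [H.+1] steps to the right a good point on it; by the gradient bound with radius
    [K %/ 2], [u] changes by less than 1 on the way. *)
Lemma maxQ_lt2_of_sparse (R : realType) (u : int * int -> R) (K H : nat) (M : R) :
  discrete_harmonic u ->
  (8 <= K)%N -> (H.+1 <= K %/ 4)%N -> 8 * H.+1%:R * M < (K %/ 2)%N%:R ->
  (forall p, Q (2 * K) p -> `|u p| <= M) ->
  (forall l : seq (int * int), uniq l ->
    all (large_in u (2 * K)) l -> (size l <= H ^ 2)%N) ->
  maxQ u K < 2.
Proof.
set bad := large_in u (2 * K) => hu K8 HK HM uM few; set r := (K %/ 2)%N in HM.
have r0 : (0 < r)%N by lia.
have M0 : 0 <= M.
  by apply: le_trans (normr_ge0 (u (0, 0))) (uM _ _); split; rewrite normr0.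
pose c := 1 + 2 * (H.+1%:R * (4 * M / r%:R)).
have c2 : c < 2.
  have rR : 0 < r%:R :> R by rewrite ltr0n.
  have : 8 * H.+1%:R * M / r%:R < 1 by rewrite ltr_pdivrMr// mul1r.
  rewrite /c; have -> : 2 * (H.+1%:R * (4 * M / r%:R)) = 8 * H.+1%:R * M / r%:R by ring.
  by move: (_ / _) => z; lra.
apply: le_lt_trans c2; apply: maxQ_le.
  by rewrite addr_ge0// !mulr_ge0// ?invr_ge0.
move=> [x y] [/= xK yK].
have inc (z : int) : uniq [seq z + d%:Z | d <- iota 1 H.+1].
  by rewrite map_inj_uniq ?iota_uniq// => a b /addrI[].
have size_inc (z : int) : (size [seq (z + d%:Z)%R | d <- iota 1 H.+1] <= H)%N = false.
  by rewrite size_map size_iota ltnn.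
have [d /= dP sd] : exists2 d, (0 < d <= H.+1)%N & sparse_row bad H (y + d%:Z).
  apply: contrapT => nex; have := few_dense_rows few (inc y); rewrite size_inc.
  suff al : all (fun j => ~~ sparse_row bad H j) [seq y + d%:Z | d <- iota 1 H.+1].
    by move=> /(_ al).
  apply/allP => _ /mapP[d + ->]; rewrite mem_iota => dI.
  by apply/negP => sd; apply: nex; exists d.
have [e /= eP ge] : exists2 e, (0 < e <= H.+1)%N & ~~ bad (x + e%:Z, y + d%:Z).
  apply: contrapT => nex; have /asboolP := sd => /(_ _ (inc x)); rewrite size_inc.
  suff al : all (fun i => bad (i, y + d%:Z)) [seq x + d%:Z | d <- iota 1 H.+1].
    by move=> /(_ al).
  apply/allP => _ /mapP[e + ->]; rewrite mem_iota => eI.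
  by apply: contrapT => /negP ge; apply: nex; exists e.
have {}ge : `|u (x + e%:Z, y + d%:Z)| <= 1.
  rewrite leNgt; apply: contra ge => ge; rewrite /bad /large_in/= ge andbT.
  by clear -xK yK dP eP HK; lia.
have step1 : `|u (x + e%:Z, y + d%:Z) - u (x, y + d%:Z)| <= H.+1%:R * (4 * M / r%:R).
  apply: (@le_trans _ _ (e%:R * (4 * M / r%:R))).
    by apply: (@harmonic_walk_bound R u r e (2 * K)) => //; rewrite /r; clear -xK yK dP eP HK; lia.
  by rewrite ler_wpM2r ?ler_nat ?divr_ge0 ?mulr_ge0//; lia.
have step2 : `|u (x, y + d%:Z) - u (x, y)| <= H.+1%:R * (4 * M / r%:R).
  apply: (@le_trans _ _ (d%:R * (4 * M / r%:R))).
    apply: (@harmonic_walk_bound R (swap_coord u) r d (2 * K) y x) => //.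
    - exact: harmonic_swap.
    - by move=> p [p1 p2]; apply: uM.
    - by rewrite /r; clear -xK yK dP eP HK; lia.
    - by rewrite /r; clear -xK yK dP eP HK; lia.
  by rewrite ler_wpM2r ?ler_nat ?divr_ge0 ?mulr_ge0//; lia.
have -> : u (x, y) = u (x + e%:Z, y + d%:Z) - (u (x + e%:Z, y + d%:Z) - u (x, y + d%:Z))
   - (u (x, y + d%:Z) - u (x, y)) by ring.
rewrite (le_trans (ler_normB _ _))// (le_trans (lerD (ler_normB _ _) (lexx _)))//.
by rewrite /c; move: ge step1 step2; lra.
Qed.

(** The base [64 * T * T.+1 ^ 2] has a logarithm of order log T, so the last inequality holds for
    all large [T]; 512 and 35 are one choice. *)
Lemma degree_constants : exists T P : nat,
  [/\ (0 < T)%N, (2 <= P)%N, (64 * T * T.+1 ^ 2 <= 2 ^ P)%N & (24 * P + 1 <= 2 * T)%N].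
Proof.
have [T TE] : exists T, T = (2 ^ 9)%N by exists (2 ^ 9)%N.
have T1 : (T.+1 <= 2 ^ 10)%N by rewrite TE.
exists T, 35%N; split; [by rewrite TE|by []| |by rewrite TE].
have -> : (2 ^ 35 = 2 ^ 6 * 2 ^ 9 * (2 ^ 10) ^ 2)%N by rewrite -expnM -!expnD.
rewrite -TE; apply: leq_mul; first exact: leqnn.
by rewrite leq_exp2r.
Qed.

Lemma power_scale (R : archiRealFieldType) (c M : R) : 2 <= c -> 1 <= M ->
  exists s : nat, c ^+ s <= M /\ M < c ^+ s.+1.
Proof.
move=> c2 M1.
have [n0 Mn0] : exists n, M < c ^+ n.
  exists (Num.bound M); apply: lt_le_trans (archi_boundP _) _; first lra.
  apply: (@le_trans _ _ (2 ^+ Num.bound M)); last by rewrite lerXn2r ?nnegrE//; lra.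
  by rewrite -natrX ler_nat ltnW// ltn_expl.
have ex : exists n, M < c ^+ n by exists n0.
case: (ex_minnP ex) => -[|s] Ms smin; first by move: Ms; rewrite expr0; lra.
exists s; split => //; rewrite leNgt; apply/negP => /smin; lia.
Qed.

(** [Y] bounds the Lagrange factor [L], and [2 * e <= 1]. The pass along sparse rows gives at most
    [2 * Y], the pass along columns at most [(2 * Y + 1) * Y <= Y ^+ 3]. *)
Lemma maxQ_le_of_sparse (R : realType) (u : int * int -> R) (K H T P s : nat) (M : R) :
  discrete_harmonic u ->
  (0 < T)%N -> (2 <= P)%N -> (64 * T * T.+1 ^ 2 <= 2 ^ P)%N -> (24 * P + 1 <= 2 * T)%N ->
  (0 < s)%N -> (260 * T.+1 * s <= K)%N -> (H <= K %/ (260 * T.+1))%N ->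
  0 <= M -> M <= 2 ^+ (12 * P * s.+1) ->
  (forall p, Q (2 * K) p -> `|u p| <= M) ->
  (forall l : seq (int * int), uniq l -> all (large_in u (2 * K)) l -> (size l <= H ^ 2)%N) ->
  maxQ u K <= 2 ^+ (3 * P * s).
Proof.
move=> hu T0 P2 TP PT s0 sK HK M0 M2 uM few.
set bad := large_in u (2 * K) in few.
(* The largest [h] allowed by [harmonic_row_bound]; rounding loses at most a factor 2, so [s * h] is
   still at least [H]. *)
pose h := (K %/ (130 * (T.+1 * s)))%N.
have D0 : (0 < 130 * (T.+1 * s))%N by rewrite !muln_gt0.
have h0 : (0 < h)%N by rewrite divn_gt0//; lia.
have hK : (130 * (T.+1 * s * h) <= K)%N.
  by have := leq_trunc_div K (130 * (T.+1 * s)); rewrite -/h; lia.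
have Hsh : (H <= s * h)%N.
  rewrite (leq_trans HK)// -[X in (_ <= X)%N](@mulnK _ (260 * T.+1)); last by lia.
  rewrite leq_div2r//; have := ltn_ceil K D0; rewrite -/h.
  have : (130 * (T.+1 * s) <= h * (130 * (T.+1 * s)))%N by rewrite leq_pmull.
  nia.
set r0 := (T.+1 * s * h)%N in hK.
pose L : R := ((64 * T * T.+1 ^ 2) ^ s)%:R; pose e := M / 2 ^+ (2 * (T * s)).
pose Y : R := 2 ^+ (P * s).
have LY : L <= Y by rewrite /L /Y -natrX ler_nat expnM leq_exp2r.
have Y4 : 4 <= Y.
  rewrite /Y (_ : 4 = 2 ^+ 2); last by rewrite expr2 -natrM.
  by rewrite ler_weXn2l ?ler1n//; nia.
have e0 : 0 <= e by rewrite divr_ge0// exprn_ge0.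
(* [12 * P * s.+1 + 1 <= (24 * P + 1) * s <= 2 * (T * s)], using [0 < s]. *)
have e1 : 2 * e <= 1.
  rewrite /e mulrA ler_pdivrMr ?exprn_gt0// mul1r.
  apply: (@le_trans _ _ (2 * 2 ^+ (12 * P * s.+1))); first by rewrite ler_wpM2l.
  by rewrite -exprS ler_weXn2l ?ler1n//; nia.
have row x j : `|x| <= K%:Z -> `|j| <= (K + r0)%N%:Z -> sparse_row bad H j ->
    `|u (x, j)| <= (1 + 2 * e) * L.
  move=> xK jK /asboolP sj.
  apply: (@harmonic_row_bound R u T s h K x j (fun i => `|u (i, j)| <= 1)) => //.
  move=> l ul al; apply: leq_trans Hsh; apply: sj => //.
  apply: sub_all al => i /andP[ir]; rewrite -ltNge => ui.
  rewrite /bad /large_in/= ui andbT -/r0 in ir *.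
  by move: xK jK ir hK; clear; move: r0 => r; lia.
apply: maxQ_le; first by rewrite exprn_ge0.
move=> [x y] [/= xK yK].
(* In the column pass the good points are those on sparse rows, where [row] supplies the bound. *)
have : `|swap_coord u (y, x)| <= ((1 + 2 * e) * L + 2 * e) * L.
  apply: (@harmonic_row_bound R (swap_coord u) T s h K y x (sparse_row bad H)) => //.
  - exact: harmonic_swap.
  - by clear -xK; lia.
  - by move=> p [p1 p2]; apply: uM.
  - by move=> j jy sj; apply: row => //; move: jy yK; rewrite -/r0; clear; move: r0 => r /=; lia.
  - move=> l ul al; apply: leq_trans Hsh; apply: (few_dense_rows few ul).
    by apply: sub_all al => i /andP[].
rewrite /swap_coord/= => /le_trans; apply.
have -> : 2 ^+ (3 * P * s) = Y ^+ 3 :> R by rewrite /Y -exprM; congr (_ ^+ _); lia.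
have L0 : 0 <= L by rewrite ler0n.
apply: (@le_trans _ _ ((2 * Y + 1) * Y)); last by rewrite exprS expr2; nra.
apply: ler_pM => //; first by rewrite addr_ge0// ?mulr_ge0//; lra.
by rewrite lerD// ler_pM//; lra.
Qed.

(** The second alternative is exponential growth in [K], stated with a power [G] to avoid roots. The
    proof takes [s] as the integer part of the logarithm of [M] to base [q0] and separates [s = 0],
    [s] at most a small multiple of [K], and larger [s]. *)
Lemma maxQ_growth (R : realType) : exists q G : nat, (0 < q)%N /\ (0 < G)%N /\
  forall (u : int * int -> R) (K : nat), discrete_harmonic u -> (q <= K)%N ->
    (forall l : seq (int * int), uniq l -> all (large_in u (2 * K)) l ->
       (size l <= (K %/ q) ^ 2)%N) ->
    2 <= maxQ u K ->
    maxQ u K ^+ 4 <= maxQ u (2 * K) \/ 2 ^+ (2 * K) <= maxQ u (2 * K) ^+ G.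
Proof.
have [T [P [T0 P2 TP PT]]] := degree_constants.
pose q0 := (2 ^ (12 * P))%N.
have q00 : (0 < q0)%N by rewrite expn_gt0.
(* The factor [260 * T.+1] serves the interpolation argument, [128 * q0] the case of bounded [M]. *)
exists (260 * T.+1 * (128 * q0))%N, (260 * T.+1)%N.
have [q qE] : exists q, q = (260 * T.+1 * (128 * q0))%N by eexists.
have qT : (260 * T.+1 <= q)%N by rewrite qE leq_pmulr// muln_gt0.
have qq0 : (128 * q0 <= q)%N by rewrite qE leq_pmull.
rewrite -qE {qE}; split; first by lia.
split; first by lia.
move=> u K hu qK few u2; set M := maxQ u (2 * K).
have M2 : 2 <= M by apply: le_trans u2 _; apply: maxQ_mono; lia.
have uM p : Q (2 * K) p -> `|u p| <= M by exact: maxQ_ge.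
have q2 : 2 <= q0%:R :> R.
  by rewrite ler_nat /q0 -{1}(expn1 2) leq_exp2l//; lia.
have M1 : 1 <= M by lra.
have [s [sM Ms]] := power_scale q2 M1.
have [s0|s0] := posnP s.
  have : maxQ u K < 2; last by rewrite ltNge u2.
  rewrite s0 expr1 in Ms.
  apply: (maxQ_lt2_of_sparse (H := (K %/ q)%N) (M := M) hu) => //; [lia| |].
  - have : (K %/ q <= K %/ 8 )%N by rewrite leq_div2l//; lia.
    by lia.
  - apply: (@le_lt_trans _ _ (8 * (K %/ q).+1 * q0)%N%:R).
      by rewrite !natrM ler_wpM2l ?mulr_ge0// ltW.
    rewrite ltr_nat.
    have : (K %/ q <= K %/ (128 * q0))%N by rewrite leq_div2l// muln_gt0.
    have : (K %/ (128 * q0) * (128 * q0) <= K)%N by exact: leq_trunc_div.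
    have : (128 * q0 <= K)%N by lia.
    move: (K %/ (128 * q0))%N (K %/ q)%N => a b; nia.
have q0E n : q0%:R ^+ n = 2 ^+ (12 * P * n) :> R by rewrite /q0 natrX -exprM.
rewrite !q0E in sM Ms.
have [sK|sK] := leqP (260 * T.+1 * s)%N K.
  left; apply: le_trans sM.
  have : maxQ u K <= 2 ^+ (3 * P * s).
    apply: (@maxQ_le_of_sparse R u K (K %/ q) T P s M) => //.
    - by rewrite leq_div2l.
    - lra.
    - exact: ltW.
  move=> le3; have -> : 2 ^+ (12 * P * s) = (2 ^+ (3 * P * s)) ^+ 4 :> R.
    by rewrite -exprM; congr (_ ^+ _); lia.
  by rewrite lerXn2r ?nnegrE// ?exprn_ge0//; lra.
(* Here [K < 260 * T.+1 * s], so already the power [260 * T.+1] of [2 ^+ (12 * P * s)] reaches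
   [2 ^+ (2 * K)]. *)
right; apply: (@le_trans _ _ ((2 ^+ (12 * P * s)) ^+ (260 * T.+1))).
  by rewrite -exprM ler_weXn2l ?ler1n//; nia.
by rewrite lerXn2r ?nnegrE ?exprn_ge0//; lra.
Qed.

(** * Iteration over dyadic scales and conclusion *)

(** Each fourth power multiplies the exponent [4 ^ j] by 4. Once the bound is exponential in the
    radius it stays so: a fourth power gives exponent [4 * K] where [2 * K] is required. *)
Lemma iterated_growth (R : realType) (m : nat -> R) (K0 G N : nat) :
  (0 < K0)%N -> 2 <= m K0 -> {homo m : x y / (x <= y)%N >-> x <= y} ->
  (forall K, (K0 <= K)%N -> (2 * K <= N)%N -> 2 <= m K ->
     m K ^+ 4 <= m (2 * K)%N \/ 2 ^+ (2 * K) <= m (2 * K)%N ^+ G) ->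
  forall j, (2 ^ j * K0 <= N)%N ->
    2 ^+ (4 ^ j) <= m (2 ^ j * K0)%N \/ 2 ^+ (2 ^ j * K0) <= m (2 ^ j * K0)%N ^+ G.
Proof.
move=> K00 m2 mono step; elim=> [|j IHj] jN.
  by left; rewrite expn0 mul1n expr1.
have EK : (2 ^ j.+1 * K0 = 2 * (2 ^ j * K0))%N by rewrite expnS mulnA.
rewrite EK in jN *; set K := (2 ^ j * K0)%N in IHj jN *.
have K0K : (K0 <= K)%N by rewrite leq_pmull// expn_gt0.
have mK2 : 2 <= m K by rewrite (le_trans m2)// mono.
have mK0 : 0 <= m K by lra.
case: (step K K0K jN mK2) => [s4|]; last by right.
have {IHj} [mK|mK] := IHj (leq_trans (leq_pmull K (ltn0Sn 1)) jN).
  left; rewrite (le_trans _ s4)// expnSr exprM.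
  by rewrite lerXn2r ?nnegrE// exprn_ge0.
right; apply: (@le_trans _ _ ((m K ^+ G) ^+ 4)).
  apply: (@le_trans _ _ ((2 ^+ K) ^+ 4)).
    by rewrite -exprM ler_weXn2l ?ler1n//; lia.
  by rewrite lerXn2r ?nnegrE ?exprn_ge0.
by rewrite -exprM mulnC exprM lerXn2r ?nnegrE ?exprn_ge0// (le_trans _ s4)// exprn_ge0.
Qed.

Lemma last_dyadic (K0 N : nat) : (0 < K0)%N -> (2 * K0 <= N)%N ->
  exists j, (2 * (2 ^ j * K0) <= N)%N /\ (N < 4 * (2 ^ j * K0))%N.
Proof.
move=> K00 KN.
have ex : exists j, (N < 2 * (2 ^ j * K0))%N.
  exists N; have := ltn_expl N (isT : (1 < 2)%N) => lt.
  by rewrite (leq_trans lt)// mulnCA leq_pmulr// muln_gt0.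
case: (ex_minnP ex) => -[|j] jN jmin; first by move: jN; rewrite expn0; lia.
exists j; split; first by rewrite leqNgt; apply/negP => /jmin; rewrite ltnn.
by move: jN; rewrite expnS; lia.
Qed.

(** Squaring the last hypothesis and cancelling one [N] through [K0 * K0 <= N] removes [K0]. Thus,
    starting from sqrt N, a bound with exponent [4 ^ j] is exponential in [N]. *)
Lemma dyadic_sqr_bound (K0 N j : nat) : (0 < K0)%N -> (K0 * K0 <= N)%N ->
  (N <= 4 * (2 ^ j * K0))%N -> (N <= 4 ^ j * 16)%N.
Proof.
rewrite (_ : 4 ^ j = 2 ^ j * 2 ^ j)%N; last by rewrite -expnMn.
move: (2 ^ j)%N => t K00 K0N Nt; have := leq_mul Nt Nt; nia.
Qed.

(** The square has at most [25 * K ^ 2] points, and rounding costs a factor 2 in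
    [K <= 2 * q * (K %/ q)], that is 4 after squaring; hence the constant 100. *)
Lemma size_large_in_le_sqr (R : realType) (u : int * int -> R) (q K : nat)
    (eps : R) (l : seq (int * int)) :
  (0 < q)%N -> (q <= K)%N -> 0 <= eps -> eps <= (100 * q%:R ^+ 2)^-1 ->
  (1 - eps) * (npoints (Q (2 * K)))%:R <=
     (npoints (Q (2 * K) `&` [set p : int * int | `|u p| <= 1]))%:R ->
  uniq l -> all (large_in u (2 * K)) l -> (size l <= (K %/ q) ^ 2)%N.
Proof.
move=> q0 qK eps_ge0 eps_le dens ul al.
have c1 : ((2 * K + 2 * K).+1 ^ 2 <= 25 * K ^ 2)%N.
  rewrite (_ : 25 * K ^ 2 = (5 * K) ^ 2)%N; last by rewrite expnMn.
  by rewrite leq_exp2r//; clear -q0 qK; lia.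
have c2 : (K ^ 2 <= 4 * q ^ 2 * (K %/ q) ^ 2)%N.
  rewrite (_ : 4 * q ^ 2 * (K %/ q) ^ 2 = (2 * (K %/ q * q)) ^ 2)%N; last by ring.
  have := ltn_ceil K q0; have : (1 <= K %/ q)%N by rewrite divn_gt0.
  rewrite leq_exp2r//; clear; move: (K %/ q)%N => d; nia.
have := size_large_in_le dens eps_ge0 ul al.
rewrite -(ler_nat R) => /le_trans; apply.
apply: (@le_trans _ _ ((100 * q%:R ^+ 2)^-1 * (25 * (4 * q ^ 2 * (K %/ q) ^ 2))%N%:R)).
  by rewrite ler_pM// ler_nat (leq_trans c1)// leq_mul2l c2.
rewrite ler_pdivrMl ?mulr_gt0 ?exprn_gt0 ?ltr0n// -natrX -!natrM ler_nat.
by apply: eq_leq; ring.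
Qed.

Theorem mainTheorem3 (R : realType) :
  exists (b eps0 : R) (N0 : nat), 0 < b /\ 0 < eps0 /\
    forall (eps : R) (N : nat), 0 < eps -> eps < eps0 -> (N0 <= N)%N ->
    forall u : int * int -> R,
      discrete_harmonic u ->
      2 <= maxQ u (Num.truncn (Num.sqrt (N%:R : R))) ->
      (forall K : nat, Num.sqrt (N%:R : R) <= K%:R -> (K <= N)%N ->
        (1 - eps) * (npoints (Q K))%:R <=
          (npoints (Q K `&` [set p : int * int | `|u p| <= 1]))%:R) ->
      expR (b * N%:R) <= maxQ u (N %/ 2)%N.
Proof.
have [q [G [q0 [G0 step]]]] := maxQ_growth R.
have G0R : 0 < G%:R :> R by rewrite ltr0n.
have q0R : 0 < q%:R :> R by rewrite ltr0n.
have ln2 : 0 < ln 2 :> R by rewrite ln_gt0// ltr1n.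
(* In base 2 the two outcomes below give exponents at least N / 16 and N / (4 G), both at least N /
   (16 G). The last witness makes the integer part of sqrt N at least [q + 2]. *)
exists (ln 2 / (16 * G%:R)), (100 * q%:R ^+ 2)^-1, ((q + 2) ^ 2)%N.
split; first by rewrite divr_gt0// mulr_gt0.
split; first by rewrite invr_gt0 mulr_gt0// exprn_gt0.
move=> eps N eps_gt0 eps_lt N_ge u hu u2 dens.
set K0 := Num.truncn _ in u2.
have sq0 : 0 <= Num.sqrt (N%:R : R) by exact: sqrtr_ge0.
have /andP[K0_le K0_gt] := truncn_itv sq0; rewrite -/K0 in K0_le K0_gt.
have K0q : (q + 2 <= K0)%N.
  rewrite /K0 truncn_ge_nat// -[leLHS]ger0_norm// -sqrtr_sqr ler_wsqrtr//.
  by rewrite -natrX ler_nat.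
have K0N : (K0 * K0 <= N)%N.
  rewrite -(ler_nat R) natrM -[leRHS](@sqr_sqrtr R)// expr2.
  by rewrite ler_pM.
have K0N2 : (2 * K0 <= N)%N.
  by rewrite (leq_trans _ K0N)// leq_mul2r (leq_trans _ K0q) ?orbT// leq_addl.
have mono : {homo maxQ u : x y / (x <= y)%N >-> x <= y}.
  by move=> x y; exact: maxQ_mono.
(* [K0] may lie below sqrt N, but the density is only used on [Q (2 * K)], and [2 * K] is at least
   [K0 + 1], which exceeds sqrt N. *)
have K0sq K : (K0 <= K)%N -> Num.sqrt (N%:R : R) <= (2 * K)%N%:R.
  move=> K0K; rewrite (le_trans (ltW K0_gt))// ler_nat mul2n -addnn -addn1.
  by rewrite leq_add// (leq_trans _ K0K)// (leq_trans _ K0q)// addn2.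
have K0_gt0 : (0 < K0)%N by rewrite (leq_trans _ K0q)// addn2.
have qK0 : (q <= K0)%N by rewrite (leq_trans _ K0q)// leq_addr.
clearbody K0; clear K0_le K0_gt K0q sq0 N_ge.
(* [2 ^ J * K0] is the last dyadic radius not above N / 2, so it exceeds N / 4. *)
have [J [J1 J2]] := last_dyadic K0_gt0 K0N2.
have grow : 2 ^+ (4 ^ J) <= maxQ u (2 ^ J * K0)%N \/
    2 ^+ (2 ^ J * K0) <= maxQ u (2 ^ J * K0)%N ^+ G.
  apply: (iterated_growth (N := N)) => // [K K0K KN mK|]; last first.
    by rewrite (leq_trans _ J1)// leq_pmull.
  have qK := leq_trans qK0 K0K.
  apply: step => // l ul al; have d := dens _ (K0sq _ K0K) KN.
  exact: size_large_in_le_sqr (ltW eps_gt0) (ltW eps_lt) d ul al.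
apply: (@le_trans _ _ (maxQ u (2 ^ J * K0)%N)); last first.
  by apply: mono; rewrite leq_divRL// mulnC.
have exp_pow n : expR (ln 2 * n%:R) = 2 ^+ n :> R.
  by rewrite mulrC expRM_natl lnK// posrE.
case: grow => grow.
  apply: le_trans grow; rewrite -exp_pow ler_expR -mulrA ler_pM2l//.
  rewrite mulrC ler_pdivrMr ?mulr_gt0//.
  apply: (@le_trans _ _ ((4 ^ J)%N%:R * 16)).
    have NJ := dyadic_sqr_bound K0_gt0 K0N (ltnW J2).
    by rewrite -(ler_nat R) natrM in NJ.
  by rewrite ler_wpM2l// ler_peMr// ler1n.
have m0 : 0 <= maxQ u (2 ^ J * K0)%N.
  by apply: (le_trans _ (mono K0 _ _)); [lra|rewrite leq_pmull// expn_gt0].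
rewrite -(ler_pXn2r G0) ?nnegrE ?expR_ge0//.
apply: le_trans grow; rewrite -exp_pow -expRM_natl ler_expR.
rewrite (_ : G%:R * _ = ln 2 * (N%:R / 16)); last by field; rewrite ?gt_eqF.
rewrite ler_pM2l// ler_pdivrMr// -natrM ler_nat.
by rewrite (leq_trans (ltnW J2))// mulnC leq_mul2l orbT.
Qed.
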